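(* Let $\mathbb{P}=(\mathcal{G},(\mathcal{D},\sqsubseteq),\delta)$ be a pattern setup and let $\mathbb{P}^{\triangledown}=(\mathcal{G},(\mathscr{A}(\mathcal{D}),\leqq),\delta^{\triangledown})$ with $\delta^{\triangledown}(g)=\{\delta(g)\}$ be its antichain completion. Then $\mathbb{P}^{\triangledown}$ is a pattern structure if and only if $\mathbb{P}$ is a pattern multistructure. Moreover, for every antichain $S\in\mathscr{A}(\mathcal{D})$, $ext^{\triangledown}(S)=\bigcap_{d\in S}ext(d)$; and, when $\mathbb{P}$ is a pattern multistructure, for every $A\subseteq\mathcal{G}$, $int^{\triangledown}(A)=cov^*(A)$, and $\mathbb{P}^{\triangledown}_{ext}=\{\bigcap\mathcal{S}\mid\mathcal{S}\subseteq\mathbb{P}_{ext}\}$, where $\bigcap\emptyset=\mathcal{G}$.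
   Context: A pattern setup is a triple $(\mathcal{G},(\mathcal{D},\sqsubseteq),\delta)$ with $\mathcal{G}$ a set, $(\mathcal{D},\sqsubseteq)$ a poset and $\delta:\mathcal{G}\to\mathcal{D}$ a map; its extent operator is $ext(d)=\{g\in\mathcal{G}\mid d\sqsubseteq\delta(g)\}$, its definable sets are $\mathbb{P}_{ext}=\{ext(d)\mid d\in\mathcal{D}\}$, $cov(A)=\{d\in\mathcal{D}\mid\forall g\in A,\ d\sqsubseteq\delta(g)\}$ and $cov^*(A)$ is the set of maximal elements of $cov(A)$. It is a pattern multistructure if $cov(A)=\{c\in\mathcal{D}\mid\exists x\in cov^*(A),\ c\sqsubseteq x\}$ for all $A\subseteq\mathcal{G}$. It is a pattern structure if every subset of $\{\delta(g)\mid g\in\mathcal{G}\}$ (including $\emptyset$) has a meet in the description poset; then $int(A)$ denotes the meet of $\{\delta(g)\mid g\in A\}$. $\mathscr{A}(\mathcal{D})$ is the set of antichains of $(\mathcal{D},\sqsubseteq)$, ordered by $S\leqq T$ iff $\downarrow S\subseteq\downarrow T$ with $\downarrow S=\{c\in\mathcal{D}\mid\exists s\in S,\ c\sqsubseteq s\}$. $ext^{\triangledown}$, $int^{\triangledown}$, $\mathbb{P}^{\triangledown}_{ext}$ denote the extent operator, intent operator and definable sets of $\mathbb{P}^{\triangledown}$. *)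

(* Defs.v *)
From HB Require Import structures.
From mathcomp Require Import all_boot all_order.
From mathcomp Require Import boolp classical_sets.

Set Implicit Arguments.
Unset Strict Implicit.
Unset Printing Implicit Defensive.

Import Order.TTheory.
Local Open Scope classical_set_scope.
Local Open Scope order_scope.

Section Posets.
Context {d : Order.disp_t} {D : porderType d}.
Implicit Types S : set D.

Definition downset S : set D := [set c | exists2 s, S s & c <= s].

Definition maximals S : set D :=
  [set x | S x /\ forall y, S y -> x <= y -> y = x].

Definition is_antichain S : Prop :=
  forall x y, S x -> S y -> x <> y -> x >< y.

End Posets.

(* A pattern setup is given by a type G of objects, a poset D of descriptions
   and a map delta : G -> D. *)
Section PatternSetups.
Context {G : Type} {d : Order.disp_t} {D : porderType d}.
Variable delta : G -> D.

Definition ext (c : D) : set G := [set g | c <= delta g].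

Definition definable : set (set G) := range ext.

Definition cov (A : set G) : set D := [set c | forall g, A g -> c <= delta g].

Definition cov_star (A : set G) : set D := maximals (cov A).

Definition pattern_multistructure : Prop :=
  forall A : set G, cov A = downset (cov_star A).

(* infimums B is the set of greatest lower bounds of B; for B = set0 these are
   the greatest elements of D. *)
Definition pattern_structure : Prop :=
  forall B : set D, B `<=` range delta -> infimums B !=set0.

Lemma image_sub_range (A : set G) : delta @` A `<=` range delta.
Proof. by move=> _ [g _ <-]; exists g. Qed.

Definition intent (hP : pattern_structure) (A : set G) : D :=
  sval (cid (hP _ (@image_sub_range A))).

Lemma intentP (hP : pattern_structure) (A : set G) :
  infimums (delta @` A) (intent hP A).
Proof. exact: (svalP (cid (hP _ (@image_sub_range A)))). Qed.

End PatternSetups.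

Definition antichain {d : Order.disp_t} (D : porderType d) : Type :=
  {S : set D | `[< is_antichain S >]}.

HB.instance Definition _ d (D : porderType d) :=
  [isSub of antichain D for sval].
HB.instance Definition _ d (D : porderType d) :=
  [Choice of antichain D by <:].

Fact antichain_display (d : Order.disp_t) : Order.disp_t.
Proof. exact: d. Qed.

Section AntichainOrder.
Context {d : Order.disp_t} {D : porderType d}.
Implicit Types S T : antichain D.

Definition antichain_le S T : bool :=
  `[< downset (val S) `<=` downset (val T) >].

Fact antichain_le_refl : reflexive antichain_le.
Proof. by move=> S; apply/asboolP. Qed.

Fact antichain_le_anti : antisymmetric antichain_le.
Proof.
have sub S T : downset (val S) `<=` downset (val T) ->
    downset (val T) `<=` downset (val S) -> val S `<=` val T.
  move=> ST TS x Sx.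
  have [y Ty xy] : downset (val T) x by apply: ST; exists x.
  have [z Sz yz] : downset (val S) y by apply: TS; exists y.
  have xz : x = z.
    apply: contrapT => /(asboolW (valP S) x z Sx Sz).
    by rewrite /Order.comparable (le_trans xy yz).
  by rewrite (_ : x = y)//; apply: le_anti; rewrite xy xz yz.
move=> S T /andP[/asboolP ST /asboolP TS].
by apply: val_inj; apply/seteqP; split; exact: sub.
Qed.

Fact antichain_le_trans : transitive antichain_le.
Proof.
by move=> T S U /asboolP ST /asboolP TU; apply/asboolP; apply: subset_trans TU.
Qed.

HB.instance Definition _ := Order.Le_isPOrder.Build (antichain_display d)
  (antichain D) antichain_le_refl antichain_le_anti antichain_le_trans.

Fact is_antichain1 (c : D) : `[< is_antichain [set c] >].
Proof. by apply/asboolP => x y -> ->. Qed.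

Definition antichain1 (c : D) : antichain D := exist _ [set c] (is_antichain1 c).

(* The antichain completion of a pattern setup is the pattern setup with the
   same objects, descriptions antichain D, and the following map. *)
Definition completion {G : Type} (delta : G -> D) (g : G) : antichain D :=
  antichain1 (delta g).

End AntichainOrder.

(* Main.v *)
(** An antichain [S] is a lower bound of [{{delta g} | g in A}] iff
    [S `<=` cov A], since [cov A] is a down-set. Hence [S] is the meet of this
    family iff [downset S = cov A], which forces [S] to be the set of maximal
    elements of [cov A]. So the meet exists iff [cov A] is generated by its
    maximal elements. An intersection [A] of definable sets is the extent of
    [cov_star A]. *)
Require Import Defs.
From mathcomp Require Import all_boot all_order.
From mathcomp Require Import boolp classical_sets.
Local Open Scope classical_set_scope.

Import Order.TTheory.
Local Open Scope order_scope.

Section Antichains.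
Context {d : Order.disp_t} {D : porderType d}.

Lemma sub_downset (S : set D) : S `<=` downset S.
Proof. by move=> x Sx; exists x. Qed.

Lemma downset_le (S : set D) x y : x <= y -> downset S y -> downset S x.
Proof. by move=> xy [z Sz yz]; exists z => //; apply: le_trans yz. Qed.

Lemma maximals_is_antichain (S : set D) : is_antichain (maximals S).
Proof.
move=> x y [Sx maxx] [Sy maxy] xNy; apply/negP => /orP[xy|yx]; apply: xNy.
  by rewrite (maxx y).
exact: maxy.
Qed.

(** A maximal [x] lies below some [y] in [S], so equals it. Conversely, if [x] in [S] lies below [y]
    in [downset S], then [x <= y <= z] for some [z] in [S], and incomparability forces [x = z],
    hence [y = x]. *)
Lemma maximals_downset (S : set D) : is_antichain S ->
  maximals (downset S) = S.
Proof.
move=> antiS; apply/seteqP; split=> x.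
  by move=> [[y Sy xy] maxx]; rewrite -(maxx y (sub_downset _ _ Sy) xy).
move=> Sx; split=> [|y [z Sz yz] xy]; first exact: sub_downset.
have xz : x = z.
  apply: contrapT => /(antiS x z Sx Sz).
  by rewrite /Order.comparable (le_trans xy yz).
by apply: le_anti; rewrite xy xz yz.
Qed.

(** Applied to [cov delta A], this makes [cov_star delta A] a description of the completion. *)
Definition antichain_maximals (S : set D) : antichain D :=
  exist _ (maximals S) (asboolT (@maximals_is_antichain S)).

Lemma antichain_leP (S T : antichain D) :
  reflect (val S `<=` downset (val T)) (S <= T).
Proof.
apply: (iffP (asboolP _)) => ST; first exact: subset_trans (@sub_downset _) ST.
by move=> x [y Sy xy]; apply: downset_le xy (ST _ Sy).
Qed.

(** Objects of the completion are described by singletons, so this test governs both its extents and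
    its lower bounds. *)
Lemma antichain_le1P (S : antichain D) (c : D) :
  reflect (forall x, val S x -> x <= c) (S <= antichain1 c).
Proof.
apply: (iffP (antichain_leP _ _)) => Sc x Sx; last by exists c => //; exact: Sc.
by have [_ ->] := Sc _ Sx.
Qed.

Lemma antichain1_leP (c : D) (S : antichain D) :
  reflect (downset (val S) c) (antichain1 c <= S).
Proof.
by apply: (iffP (antichain_leP _ _)) => [|Sc _ ->]; [apply|].
Qed.

End Antichains.

Section Completion.
Context {G : Type} {d : Order.disp_t} {D : porderType d}.
Variable delta : G -> D.

Lemma cov_le (A : set G) x y : x <= y -> cov delta A y -> cov delta A x.
Proof. by move=> xy Ay g Ag; apply: le_trans xy (Ay g Ag). Qed.

Lemma lbound_completion (A : set G) (S : antichain D) :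
  lbound (completion delta @` A) S <-> val S `<=` cov delta A.
Proof.
split=> [lbS x Sx g Ag|SA _ [g Ag <-]].
  by move/antichain_le1P: (lbS _ (imageP (completion delta) Ag)); apply.
by apply/antichain_le1P => x /SA; apply.
Qed.

Lemma infimums_completion (A : set G) (S : antichain D) :
  infimums (completion delta @` A) S <-> downset (val S) = cov delta A.
Proof.
split=> [[/lbound_completion SA ubS]|SA].
  apply/seteqP; split=> [x [y /SA Ay xy]|c Ac]; first exact: cov_le xy Ay.
  (* For [c] in [cov delta A], the singleton of [c] is itself a lower bound, hence lies below the
     meet [S]. *)
  by apply/antichain1_leP/ubS/lbound_completion => _ ->.
split=> [|T /lbound_completion TA].
  by apply/lbound_completion; rewrite -SA; apply: sub_downset.
by apply/antichain_leP; rewrite SA.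
Qed.

Lemma downset_cov_star (A : set G) (S : antichain D) :
  downset (val S) = cov delta A -> val S = cov_star delta A.
Proof.
by rewrite /cov_star => <-; rewrite maximals_downset//; exact: asboolW (valP S).
Qed.

Lemma pattern_structure_completion :
  pattern_structure (completion delta) <-> pattern_multistructure delta.
Proof.
split=> [hP A|hM B Bdelta].
  have [S /infimums_completion SA] := hP _ (@image_sub_range _ _ _ _ A).
  by rewrite -(downset_cov_star _ _ SA) SA.
(* As [B] lies in the range, it is the image of a set of objects, the case covered by
   [infimums_completion]. *)
have -> : B = completion delta @` (completion delta @^-1` B).
  apply/seteqP; split=> [T BT|_ [g Bg <-]//].
  by have [g _ gT] := Bdelta _ BT; exists g => //=; rewrite gT.
set A := _ @^-1` _.
by exists (antichain_maximals (cov delta A)); apply/infimums_completion/esym/hM.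
Qed.

Lemma ext_completion (S : antichain D) :
  ext (completion delta) S = \bigcap_(c in val S) ext delta c.
Proof. by apply/seteqP; split=> g /antichain_le1P. Qed.

Lemma intent_completion (hP : pattern_structure (completion delta))
    (A : set G) : val (intent hP A) = cov_star delta A.
Proof. exact/downset_cov_star/infimums_completion/intentP. Qed.

Lemma definable_completion : pattern_multistructure delta ->
  definable (completion delta) =
  [set \bigcap_(X in F) X | F in [set F | F `<=` definable delta]].
Proof.
move=> hM; apply/seteqP; split=> [_ [S _ <-]|_ [F Fdef <-]].
  (* The empty antichain gives the empty family, whose intersection is all of [G]. *)
  exists (ext delta @` val S); first by move=> _ [c _ <-]; exists c.
  by rewrite bigcap_image ext_completion.
set A := \bigcap_(X in F) X.
exists (antichain_maximals (cov delta A)) => //; rewrite ext_completion.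
apply/seteqP; split=> [g gS X FX|g Ag c [Ac _]]; last exact: Ac.
(* Write [X] as the extent of [c]. Since [A] is contained in [X], [c] is in [cov delta A], so [hM]
   puts it below a maximal [x]; as [g] is in the extent of [x], it is in that of [c]. *)
have [c _ cX] := Fdef _ FX.
have : cov delta A c by move=> h /(_ X FX); rewrite -cX.
by rewrite hM -cX => -[x /gS]; rewrite /ext/= => xg cx; apply: le_trans xg.
Qed.

End Completion.

Theorem theorem8p6 (G : Type) (d : Order.disp_t) (D : porderType d)
    (delta : G -> D) :
  [/\ pattern_structure (completion delta) <-> pattern_multistructure delta,
      forall S : antichain D,
        ext (completion delta) S = \bigcap_(c in val S) ext delta c,
      pattern_multistructure delta ->
        forall (hP : pattern_structure (completion delta)) (A : set G),
          val (intent hP A) = cov_star delta A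
    & pattern_multistructure delta ->
        definable (completion delta) =
        [set \bigcap_(X in F) X | F in [set F | F `<=` definable delta]]].
Proof.
split=> [|S|_ hP A|].
- exact: pattern_structure_completion.
- exact: ext_completion.
- exact: intent_completion.
- exact: definable_completion.
Qed.
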